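(* Let $E$ be a nonzero reflexive real Banach space, let $f,g\colon E\times E^*\to\,]{-}\infty,\infty]$ be proper convex lower semicontinuous BC--functions such that $\bigcup_{\lambda>0}\lambda[\pi_1\mathrm{dom}\,f-\pi_1\mathrm{dom}\,g]$ is a closed linear subspace of $E$. Then $\{(x,s^*+t^* )\colon (x,s^* )\in{\cal P}_q(f),\ (x,t^* )\in{\cal P}_q(g)\}$ is a maximally monotone subset of $E\times E^*$.
   Context: $\pi_1(x,x^* ):=x$; $\mathrm{dom}\,f:=\{(x,x^* )\colon f(x,x^* )\in\mathbb{R}\}$. On $E\times E^*$ set $\lfloor(x,x^* ),(y,y^* )\rfloor:=\langle x,y^*\rangle+\langle y,x^*\rangle$ and $q(x,x^* ):=\langle x,x^*\rangle$. For $k$ on $E\times E^*$, $k^@(y,y^* ):=\sup_{(x,x^* )}[\lfloor(x,x^* ),(y,y^* )\rfloor-k(x,x^* )]$; a BC--function is a proper convex $k$ with $k^@\ge k\ge q$; ${\cal P}_q(k):=\{(x,x^* )\colon k(x,x^* )=\langle x,x^*\rangle\}$. A set $A\subset E\times E^*$ is monotone if nonempty with $\langle x-y,x^*-y^*\rangle\ge0$ on $A$, maximally monotone if not properly contained in another monotone set. *)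

(* Defs.v *)
From HB Require Import structures.
From mathcomp Require Import all_boot all_order all_algebra.
From mathcomp Require Import all_classical all_reals all_analysis.
Set Implicit Arguments. Unset Strict Implicit. Unset Printing Implicit Defensive.
Import Order.TTheory GRing.Theory Num.Theory.
Import numFieldNormedType.Exports.
Local Open Scope classical_set_scope.
Local Open Scope ring_scope.

Definition is_dual (R : realType) (E : normedModType R) (u : E -> R) : Prop :=
  (forall (a : R) (x y : E), u (a *: x + y) = a * u x + u y) /\ continuous u.

Definition dual (R : realType) (E : normedModType R) := {u : E -> R | is_dual u}.

Definition dapp (R : realType) (E : normedModType R) (u : dual E) : E -> R :=
  proj1_sig u.

Definition dnorm (R : realType) (E : normedModType R) (u : dual E) : R :=
  sup [set `|dapp u x| | x in [set x : E | `|x| <= 1]].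

Definition reflexive_space (R : realType) (E : normedModType R) : Prop :=
  forall phi : dual E -> R,
    (forall (a : R) (u v w : dual E),
        (forall x, dapp w x = a * dapp u x + dapp v x) ->
        phi w = a * phi u + phi v) ->
    (exists C : R, forall u : dual E, `|phi u| <= C * dnorm u) ->
    exists x : E, forall u : dual E, phi u = dapp u x.

Definition qf (R : realType) (E : normedModType R) (z : E * dual E) : R :=
  dapp z.2 z.1.

Definition bil (R : realType) (E : normedModType R) (z w : E * dual E) : R :=
  dapp w.2 z.1 + dapp z.2 w.1.

Definition proper_fun (R : realType) (E : normedModType R)
  (k : E * dual E -> \bar R) : Prop :=
  (forall z, k z != -oo%E) /\ (exists z, k z \is a fin_num).

Definition convex_fun (R : realType) (E : normedModType R)
  (k : E * dual E -> \bar R) : Prop :=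
  forall (t : R) (z w : E * dual E) (v : dual E),
    0 < t < 1 ->
    (forall y, dapp v y = t * dapp z.2 y + (1 - t) * dapp w.2 y) ->
    (k ((t *: z.1 + (1 - t) *: w.1)%R, v) <= t%:E * k z + (1 - t)%:E * k w)%E.

Definition lsc_fun (R : realType) (E : normedModType R)
  (k : E * dual E -> \bar R) : Prop :=
  forall (z : E * dual E) (a : \bar R), (a < k z)%E ->
    exists2 e : R, 0 < e & forall w : E * dual E,
      `|w.1 - z.1| < e ->
      (forall v : dual E, (forall y, dapp v y = dapp w.2 y - dapp z.2 y) -> dnorm v < e) ->
      (a < k w)%E.

Definition fconj (R : realType) (E : normedModType R)
  (k : E * dual E -> \bar R) (w : E * dual E) : \bar R :=
  ereal_sup [set ((bil z w)%:E - k z)%E | z in [set: E * dual E]].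

Definition BC_fun (R : realType) (E : normedModType R)
  (k : E * dual E -> \bar R) : Prop :=
  proper_fun k /\ convex_fun k /\
  (forall z, (k z <= fconj k z)%E) /\ (forall z, ((qf z)%:E <= k z)%E).

Definition Pq (R : realType) (E : normedModType R)
  (k : E * dual E -> \bar R) : set (E * dual E) :=
  [set z | k z = (qf z)%:E].

Definition pi1_dom (R : realType) (E : normedModType R)
  (k : E * dual E -> \bar R) : set E :=
  [set x | exists u : dual E, k (x, u) \is a fin_num].

Definition monotone_set (R : realType) (E : normedModType R)
  (A : set (E * dual E)) : Prop :=
  A !=set0 /\
  forall z w, A z -> A w -> 0 <= dapp z.2 (z.1 - w.1) - dapp w.2 (z.1 - w.1).

Definition max_monotone (R : realType) (E : normedModType R)
  (A : set (E * dual E)) : Prop :=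
  monotone_set A /\
  forall B, monotone_set B -> A `<=` B -> B = A.

Definition closed_subspace (R : realType) (E : normedModType R) (S : set E) : Prop :=
  closed S /\ S 0 /\ (forall (a : R) x y, S x -> S y -> S (a *: x + y)).

(* Main.v *)
(* Let [q (x, x') = <x, x'>]. Given (y, y'), we look for (x, s, t) making
     f (x, s) + g (x, t) - <x, y'> - <y, s + t> + <y, y'>
       + |x - y|^2 / 2 + |s + t - y'|^2 / 2
   nonpositive. Since f, g >= q, this expression is nonnegative, so it then
   vanishes and (x, s), (x, t) lie in P_q f and P_q g; moreover x = y and
   s + t = y' as soon as (y, y') is monotonically related to (x, s + t).
   As f <= f^@ and g <= g^@, it suffices to find such a triple with the
   conjugates in place of f and g, and this is the dual of a convex
   minimisation problem of the same shape whose value is >= 0: a subgradient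
   at 0 of its marginal function, read through reflexivity, is the triple.
   The subgradient comes from the Hahn-Banach theorem once the marginal function
   is bounded above near 0, in the directions allowed by the closed subspace
   F = U_l l (pi_1 dom f - pi_1 dom g). That bound is the Attouch-Brezis argument:
   by Baire's theorem the closure in F of the set of differences a - b, with (a, .)
   and (b, .) in bounded sublevel sets of f and g, is a neighbourhood of 0, and
   the closure can be removed by summing convex series, as f and g are lsc. *)

Require Import Defs.
From HB Require Import structures.
From mathcomp Require Import all_boot all_order all_algebra.
From mathcomp Require Import all_classical all_reals all_analysis.
From mathcomp Require Import ring lra.
Import Order.TTheory GRing.Theory Num.Theory.
Import numFieldNormedType.Exports.
Local Open Scope classical_set_scope.
Local Open Scope ring_scope.

Set Implicit Arguments.
Unset Strict Implicit.

(** * The Hahn-Banach theorem *)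

(** Only an inequality for [0 < t] is demanded; using it for [t^-1] too gives equality, and [t = 2],
    [t = 2^-1] at the origin give [p 0 = 0]. *)
Definition sublinear (R : realType) (V : lmodType R) (p : V -> R) : Prop :=
  (forall x y, p (x + y) <= p x + p y) /\
  (forall (t : R) x, 0 < t -> p (t *: x) <= t * p x).

(** Infima over [r] and [s] can be taken separately, so the rules for [S] pass to [inf]. All
    auxiliary functionals of this part, including the lower bound of a chain, are obtained this
    way. *)
Lemma inf_sublinear (R : realType) (V : lmodType R) (S : V -> set R) :
  (forall z, has_inf (S z)) ->
  (forall x y r s, S x r -> S y s -> S (x + y) (r + s)) ->
  (forall (t : R) x r, 0 < t -> S x r -> S (t *: x) (t * r)) ->
  sublinear (fun z => inf (S z)).
Proof.
move=> infS addS scaleS; split=> [x y|t x t0].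
  rewrite -lerBlDl; apply: lb_le_inf; first by case: (infS y).
  move=> s Ss; rewrite lerBlDr -lerBlDl; apply: lb_le_inf.
    by case: (infS x).
  move=> r Sr; rewrite lerBlDr; apply: ge_inf; last exact: addS.
  by case: (infS (x + y)).
rewrite mulrC -ler_pdivrMr //; apply: lb_le_inf; first by case: (infS x).
move=> r Sr; rewrite ler_pdivrMr // mulrC; apply: ge_inf; last exact: scaleS.
by case: (infS (t *: x)).
Qed.

Section sublinear_theory.
Variables (R : realType) (V : lmodType R) (p : V -> R).
Hypothesis slp : sublinear p.

Lemma sublinear0 : p 0 = 0.
Proof.
case: slp => _ pZ.
have := pZ 2 0 (ltr0Sn _ 1); have := pZ 2^-1 0.
by rewrite invr_gt0 ltr0Sn !scaler0 => /(_ isT); lra.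
Qed.

Lemma sublinear_ge x : - p (- x) <= p x.
Proof.
have [pD _] := slp; have := pD x (- x).
by rewrite subrr sublinear0; lra.
Qed.

Lemma sublinearZ t x : 0 < t -> p (t *: x) = t * p x.
Proof.
case: slp => _ pZ t0; apply/eqP; rewrite eq_le pZ //=.
rewrite mulrC -ler_pdivlMr // mulrC.
apply: le_trans (pZ _ _ _); last by rewrite invr_gt0.
by rewrite scalerA mulVf ?scale1r // gt_eqF.
Qed.

End sublinear_theory.

(* A pointwise minimal sublinear functional [q] is linear: it coincides with
   the sublinear functional [x |-> inf_(t >= 0) (q (x + t y) - t q y)] below
   it, whence [q x + q y <= q (x + y)]. *)
Lemma minimal_sublinear_additive (R : realType) (V : lmodType R) (q : V -> R) :
  sublinear q ->
  (forall q', sublinear q' -> (forall x, q' x <= q x) -> q' = q) ->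
  forall x y, q (x + y) = q x + q y.
Proof.
move=> slq minq x y; have [qD qZ] := slq.
pose S z := [set r | exists2 t, 0 <= t & q (z + t *: y) - t * q y <= r].
have q_scale t : 0 <= t -> q (t *: y) = t * q y.
  rewrite le_eqVlt => /orP[/eqP <-|t0]; last exact: sublinearZ.
  by rewrite scale0r mul0r sublinear0.
have infS z : has_inf (S z).
  split; first by exists (q z), 0 => //; rewrite scale0r addr0 mul0r subr0.
  exists (- q (- z)) => r [t t0]; apply: le_trans.
  have := qD (z + t *: y) (- z).
  by rewrite addrAC subrr add0r q_scale //; lra.
have slS : sublinear (fun z => inf (S z)).
  apply: inf_sublinear => // [a b r s [t t0 rt] [u u0 su]|t a r t0 [u u0 ru]].
    exists (t + u); first exact: addr_ge0.
    have := qD (a + t *: y) (b + u *: y).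
    by rewrite addrACA -scalerDl; lra.
  exists (t * u); first by rewrite mulr_ge0 // ltW.
  rewrite -scalerA -scalerDr sublinearZ // -mulrA -mulrBr.
  by rewrite ler_pM2l.
have Sq z t : 0 <= t -> inf (S z) <= q (z + t *: y) - t * q y.
  by move=> t0; apply: ge_inf; [case: (infS z)|exists t].
have /(congr1 (@^~ x)) /= infq : (fun z => inf (S z)) = q.
  by apply: minq => // z; have := Sq z 0 (lexx _); rewrite scale0r addr0; lra.
apply/eqP; rewrite eq_le qD /=.
by have := Sq x 1 ler01; rewrite infq scale1r; lra.
Qed.

Lemma hahn_banach (R : realType) (V : lmodType R) (p : V -> R) :
  sublinear p ->
  exists l : V -> R, linear_for *%R l /\ forall x, l x <= p x.
Proof.
move=> slp; pose Q q := sublinear q /\ forall x : V, q x <= p x.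
pose T := {q : V -> R | Q q}.
(* The order is reversed: maximal elements for Zorn are minimal sublinear functionals, and a
   nonempty chain is bounded by its pointwise infimum, finite because each [q z] is at least
   [- p (- z)]. *)
pose le (q1 q2 : T) := `[< forall x, sval q2 x <= sval q1 x >].
have [| | |A totA|[q [slq qp]] qmin] := @Zorn T le.
- by move=> q; apply/asboolP.
- move=> q1 q2 q3 /asboolP h12 /asboolP h23; apply/asboolP => x.
  exact: le_trans (h12 x).
- move=> [q1 h1] [q2 h2] /asboolP /= h12 /asboolP /= h21; apply: eq_exist => /=.
  by apply/funext => x; apply/le_anti; rewrite h12 h21.
- have [[q0 Aq0]|A0] := pselect (A !=set0); last first.
    by exists (exist Q p (conj slp (fun x => lexx (p x)))) => s As; case: A0; exists s.
  pose S z := [set r | exists2 q, A q & sval q z <= r].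
  have infS z : has_inf (S z).
    split; first by exists (sval q0 z), q0.
    exists (- p (- z)) => r [[q [slq qp]] _ /=]; apply: le_trans.
    by have := qp (- z); have := sublinear_ge slq z; lra.
  have slS : sublinear (fun z => inf (S z)).
    apply: inf_sublinear => // [x y r s [q Aq qr] [q' Aq' qs]|t x r t0 [q Aq qr]].
      have [qq'|qq'] := totA q q' Aq Aq'.
        exists q' => //; have [[q'D _] _] := svalP q'.
        by apply: le_trans (q'D _ _) _; move/asboolP: qq' => /(_ x); lra.
      exists q => //; have [[qD _] _] := svalP q.
      by apply: le_trans (qD _ _) _; move/asboolP: qq' => /(_ y); lra.
    exists q => //; have [slq _] := svalP q.
    by rewrite sublinearZ // ler_pM2l.
  have Sle q z : A q -> inf (S z) <= sval q z.
    by move=> Aq; apply: ge_inf; [case: (infS z)|exists q].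
  have Sp z : inf (S z) <= p z.
    by apply: le_trans (Sle _ z Aq0) _; case: (svalP q0).
  by exists (exist Q _ (conj slS Sp)) => q Aq; apply/asboolP => z; exact: Sle.
have qD := minimal_sublinear_additive slq.
have {}qD x y : q (x + y) = q x + q y.
  apply: qD => q' slq' q'q.
  have q'p z : q' z <= p z by exact: le_trans (q'q z) (qp z).
  by have /(congr1 sval) := qmin (exist Q q' (conj slq' q'p)) (asboolT q'q).
have qN x : q (- x) = - q x.
  by have := qD x (- x); rewrite subrr sublinear0 //; lra.
exists q; split=> // a x y; rewrite qD; congr (_ + _).
have [a0|a0|->] := ltrgtP a 0; last by rewrite scale0r mul0r sublinear0.
  apply: oppr_inj; rewrite -qN -scaleNr -mulNr.
  by apply: sublinearZ => //; rewrite oppr_gt0.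
exact: sublinearZ.
Qed.

(* [l] is a linear minorant of [z |-> inf (t r + N (z - t x))], the infimum
   over [t > 0] and [(x, r)] in [S]. *)
Lemma sandwich (R : realType) (V : lmodType R) (N : V -> R) (S : V -> R -> Prop) :
  sublinear N -> (forall x, N (- x) = N x) ->
  (exists x r, S x r) ->
  (forall (t : R) x y r s, 0 < t < 1 -> S x r -> S y s ->
     S (t *: x + (1 - t) *: y) (t * r + (1 - t) * s)) ->
  (forall x r, S x r -> 0 <= r + N x) ->
  exists l : V -> R, [/\ linear_for *%R l, forall x, l x <= N x &
    forall x r, S x r -> l x <= r].
Proof.
move=> slN NN [x0 [r0 S0]] convS S_ge; have [ND NZ] := slN.
pose P z := [set r' | exists t x r,
  [/\ 0 < t, S x r & t * r + N (z - t *: x) <= r']].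
have infP z : has_inf (P z).
  split; first by exists (1 * r0 + N (z - 1 *: x0)), 1, x0, r0.
  exists (- N z) => r' [t [x [r [t0 Sr]]]]; apply: le_trans.
  have : 0 <= t * (r + N x) by rewrite mulr_ge0 ?S_ge // ltW.
  have := ND (- (z - t *: x)) z.
  by rewrite NN opprB subrK sublinearZ // mulrDr; lra.
have slP : sublinear (fun z => inf (P z)).
  apply: inf_sublinear => //; last first.
    move=> u z r' u0 [t [x [r [t0 Sr rP]]]].
    exists (u * t), x, r; split => //; first exact: mulr_gt0.
    by rewrite -scalerA -scalerBr sublinearZ // -mulrA -mulrDr ler_pM2l.
  move=> z w r' s' [t [x [r [t0 Sr rP]]]] [u [y [s [u0 Ss sP]]]].
  have tu0 : 0 < t + u by exact: addr_gt0.
  have tuN : t + u != 0 by rewrite gt_eqF.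
  (* With [c = t / (t + u)], [t x + u y] is [t + u] times a convex combination, so the cone over [S]
     is closed under sums. *)
  have [c [c01 ct c1u]] : exists c,
      [/\ 0 < c < 1, (t + u) * c = t & (t + u) * (1 - c) = u].
    exists (t / (t + u)); split; first 1 last.
    - by rewrite mulrC divfK.
    - by rewrite mulrBr mulr1 [X in _ - X]mulrC divfK // addrAC subrr add0r.
    - by rewrite divr_gt0 //= ltr_pdivrMr // mul1r ltrDl.
  exists (t + u), (c *: x + (1 - c) *: y), (c * r + (1 - c) * s).
  split => //; first exact: convS.
  rewrite mulrDr !mulrA ct c1u scalerDr !scalerA ct c1u opprD addrACA.
  by have := ND (z - t *: x) (w - u *: y); lra.
have [l [linl lP]] := hahn_banach slP.
have lle z t x r : 0 < t -> S x r -> l z <= t * r + N (z - t *: x).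
  move=> t0 Sr; apply: le_trans (lP z) _; apply: ge_inf; first by case: (infP z).
  by exists t, x, r.
exists l; split => // [z|x r Sr]; last first.
  by have := lle x 1 _ _ ltr01 Sr; rewrite scale1r subrr sublinear0 //; lra.
(* One point of [S] at a small scale [t] gives [l z <= N z + t (r0 + N x0)]. Take [t = e / k]; the
   [+ 1] keeps [k] positive even if [r0 + N x0 = 0]. *)
apply/ler_addgt0Pr => e e0.
pose k := r0 + N x0 + 1.
have k0 : 0 < k by have := S_ge _ _ S0; rewrite /k; lra.
have t0 : 0 < e / k by exact: divr_gt0.
have := lle z _ _ _ t0 S0; have := ND z (- (e / k *: x0)).
rewrite NN sublinearZ //.
have : e / k * (r0 + N x0 + 1) = e by rewrite divfK // gt_eqF.
by rewrite !mulrDr; lra.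
Qed.

(** * The dual space *)

Section dual_module.
Variables (R : realType) (E : normedModType R).
Implicit Types (u v : dual E) (x y : E) (a : R).

Lemma dual_ext u v : (forall x, dapp u x = dapp v x) -> u = v.
Proof.
case: u v => [u hu] [v hv] /= uv; apply: eq_exist => /=.
exact/funext.
Qed.

Lemma dapp_linear u a x y : dapp u (a *: x + y) = a * dapp u x + dapp u y.
Proof. by case: u => u [ulin ucont]; exact: ulin. Qed.

Lemma dapp_continuous u : continuous (dapp u).
Proof. by case: u => u []. Qed.

Lemma dapp0 u : dapp u 0 = 0.
Proof. by have := dapp_linear u 1 0 0; rewrite scaler0 addr0; lra. Qed.

Lemma dappD u x y : dapp u (x + y) = dapp u x + dapp u y.
Proof. by rewrite -[x]scale1r dapp_linear mul1r scale1r. Qed.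

Lemma dappZ u a x : dapp u (a *: x) = a * dapp u x.
Proof. by rewrite -[a *: x]addr0 dapp_linear dapp0 addr0. Qed.

Lemma dappN u x : dapp u (- x) = - dapp u x.
Proof. by rewrite -scaleN1r dappZ mulN1r. Qed.

Lemma dappB u x y : dapp u (x - y) = dapp u x - dapp u y.
Proof. by rewrite dappD dappN. Qed.

Lemma is_dual_zero : is_dual (fun _ : E => 0 : R).
Proof.
split=> [a x y|]; last exact: cst_continuous.
by rewrite mulr0 addr0.
Qed.

Lemma is_dual_add u v : is_dual (fun x => dapp u x + dapp v x).
Proof.
split=> [a x y|x]; first by rewrite !dapp_linear; ring.
by apply: cvgD; exact: dapp_continuous.
Qed.

Lemma is_dual_scale a u : is_dual (fun x => a * dapp u x).
Proof.
split=> [b x y|x]; first by rewrite !dapp_linear; ring.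
by apply: cvgMr; exact: dapp_continuous.
Qed.

Definition dual_zero : dual E := exist _ _ is_dual_zero.
Definition dual_add u v : dual E := exist _ _ (is_dual_add u v).
Definition dual_scale a u : dual E := exist _ _ (is_dual_scale a u).
Definition dual_opp u : dual E := dual_scale (-1) u.

Lemma dual_addA : associative dual_add.
Proof. by move=> u v w; apply: dual_ext => x /=; rewrite /dapp /= addrA. Qed.

Lemma dual_addC : commutative dual_add.
Proof. by move=> u v; apply: dual_ext => x; rewrite /dapp /= addrC. Qed.

Lemma dual_add0 : left_id dual_zero dual_add.
Proof. by move=> u; apply: dual_ext => x; rewrite /dapp /= add0r. Qed.

Lemma dual_addN : left_inverse dual_zero dual_opp dual_add.
Proof. by move=> u; apply: dual_ext => x; rewrite /dapp /= /dapp; lra. Qed.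

(** Hahn-Banach will be applied on a product with [dual E] as a factor, so [dual E] must be a vector
    space; its norm stays the plain function [dnorm]. *)
HB.instance Definition _ := gen_eqMixin (dual E).
HB.instance Definition _ := gen_choiceMixin (dual E).
HB.instance Definition _ :=
  GRing.isZmodule.Build (dual E) dual_addA dual_addC dual_add0 dual_addN.

Lemma dual_scaleA a b u : dual_scale a (dual_scale b u) = dual_scale (a * b) u.
Proof. by apply: dual_ext => x; rewrite /dapp /= mulrA. Qed.

Lemma dual_scale1 : left_id 1 dual_scale.
Proof. by move=> u; apply: dual_ext => x; rewrite /dapp /= mul1r. Qed.

Lemma dual_scaleDr : right_distributive dual_scale +%R.
Proof. by move=> a u v; apply: dual_ext => x; rewrite /dapp /= mulrDr. Qed.

Lemma dual_scaleDl u : {morph dual_scale^~ u : a b / a + b}.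
Proof. by move=> a b; apply: dual_ext => x; rewrite /dapp /= mulrDl. Qed.

HB.instance Definition _ := GRing.Zmodule_isLmodule.Build R (dual E)
  dual_scaleA dual_scale1 dual_scaleDr dual_scaleDl.

Lemma dual_addE u v x : dapp (u + v) x = dapp u x + dapp v x.
Proof. by []. Qed.

Lemma dual_scaleE a u x : dapp (a *: u) x = a * dapp u x.
Proof. by []. Qed.

Lemma dual_oppE u x : dapp (- u) x = - dapp u x.
Proof. by rewrite -scaleN1r dual_scaleE mulN1r. Qed.

Lemma dual_zeroE x : dapp (0 : dual E) x = 0.
Proof. by []. Qed.

Definition dualE := (dual_addE, dual_scaleE, dual_oppE, dual_zeroE).

Lemma dual_bounded u : exists2 C : R, 0 <= C & forall x, `|dapp u x| <= C * `|x|.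
Proof.
have [ulin ucont] := svalP u.
have /cvgrPdist_lt /(_ 1 ltr01) := ucont 0.
rewrite -[sval u]/(dapp u) dapp0 => /nbhs_ballP [d /= d0 ud].
exists (2 / d) => [|x]; first by rewrite divr_ge0 // ltW.
have [->|x0] := eqVneq x 0; first by rewrite dapp0 !normr0 mulr0.
have nx : 0 < `|x| by rewrite normr_gt0.
(* [c *: x] has norm [d / 2], inside the ball where [u] stays below 1 in absolute value. *)
pose c := d / 2 / `|x|.
have c0 : 0 < c by rewrite /c !divr_gt0.
have /ud : ball 0 d (c *: x).
  rewrite -ball_normE /ball_ /= sub0r normrN normrZ gtr0_norm // divfK ?gt_eqF //.
  by rewrite ltr_pdivrMr // mulr_natr mulr2n; lra.
rewrite sub0r normrN dappZ normrM (gtr0_norm c0) mulrC -ltr_pdivlMr //.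
by rewrite mul1r /c invf_div mulrC invf_div => /ltW; rewrite mulrC.
Qed.

Lemma bounded_is_dual (u : E -> R) (C : R) :
  linear_for *%R u -> (forall x, `|u x| <= C * `|x|) -> is_dual u.
Proof.
move=> ulin ubd; split; first exact: ulin.
have uB x y : u (x - y) = u x - u y.
  by rewrite addrC -scaleN1r ulin mulN1r addrC.
move=> x; apply/cvgrPdist_lt => e e0.
have C1 : 0 < `|C| + 1 by rewrite ltr_wpDl.
near=> y; rewrite -uB; apply: (le_lt_trans (ubd _)).
apply: (@le_lt_trans _ _ ((`|C| + 1) * `|x - y|)).
  by rewrite ler_wpM2r // (le_trans (ler_norm C)) // lerDl.
rewrite mulrC -ltr_pdivlMr //.
near: y; apply: cvgr_dist_lt; [exact: cvg_id|exact: divr_gt0].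
Unshelve. all: by end_near.
Qed.

(** This excludes the default value 0 that [sup] takes on unbounded sets. *)
Lemma dnorm_has_sup u : has_sup [set `|dapp u x| | x in [set x : E | `|x| <= 1]].
Proof.
have [C C0 uC] := dual_bounded u; split.
  by exists `|dapp u 0|, 0 => //=; rewrite normr0.
exists C => _ [x /= x1 <-]; apply: le_trans (uC x) _.
by rewrite ler_piMr.
Qed.

Lemma dnorm_ge0 u : 0 <= dnorm u.
Proof.
apply: sup_upper_bound (dnorm_has_sup u) _ _.
by exists 0; rewrite /= ?normr0 ?dapp0 ?normr0.
Qed.

Lemma dapp_le_dnorm u x : `|dapp u x| <= dnorm u * `|x|.
Proof.
have [->|x0] := eqVneq x 0; first by rewrite dapp0 !normr0 mulr0.
have nx : 0 < `|x| by rewrite normr_gt0.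
rewrite -ler_pdivrMr //.
have -> : `|dapp u x| / `|x| = `|dapp u (`|x|^-1 *: x)|.
  by rewrite dappZ normrM ger0_norm ?invr_ge0 // mulrC.
apply: sup_upper_bound (dnorm_has_sup u) _ _.
exists (`|x|^-1 *: x) => //=.
by rewrite normrZ ger0_norm ?invr_ge0 // mulVf // gt_eqF.
Qed.

Lemma dnorm_le u (C : R) : 0 <= C -> (forall x, `|dapp u x| <= C * `|x|) -> dnorm u <= C.
Proof.
move=> C0 uC; apply: ge_sup; first by case: (dnorm_has_sup u).
move=> _ [x /= x1 <-]; apply: le_trans (uC x) _.
by rewrite ler_piMr.
Qed.

Lemma dnormD u v : dnorm (u + v) <= dnorm u + dnorm v.
Proof.
apply: dnorm_le => [|x]; first by rewrite addr_ge0 // dnorm_ge0.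
rewrite dualE mulrDl; apply: le_trans (ler_normD _ _) _.
by apply: lerD; exact: dapp_le_dnorm.
Qed.

Lemma dnormZ_le a u : dnorm (a *: u) <= `|a| * dnorm u.
Proof.
apply: dnorm_le => [|x]; first by rewrite mulr_ge0 // dnorm_ge0.
by rewrite dualE normrM -mulrA ler_wpM2l // dapp_le_dnorm.
Qed.

Lemma dnormN u : dnorm (- u) = dnorm u.
Proof.
have le v : dnorm (- v) <= dnorm v.
  by rewrite -scaleN1r (le_trans (dnormZ_le _ _)) // normrN1 mul1r.
by apply/le_anti; rewrite le -{1}[u]opprK le.
Qed.

Lemma dnorm0 : dnorm (0 : dual E) = 0.
Proof.
apply/le_anti; rewrite dnorm_ge0 andbT; apply: dnorm_le => // x.
by rewrite dual_zeroE normr0 mul0r.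
Qed.

Lemma dnorm_sublinear : sublinear (@dnorm R E).
Proof.
split=> [u v|t u t0]; first exact: dnormD.
by rewrite -[X in X * _](gtr0_norm t0) dnormZ_le.
Qed.

Lemma norm_sublinear : sublinear (fun x : E => `|x|).
Proof.
by split=> [x y|t x t0]; [exact: ler_normD|rewrite normrZ gtr0_norm].
Qed.

(** Sandwiching with the single constraint [l (- x) <= - |x|] under the norm forces [l x = |x|]; the
    multiple [|x| *: l] then lies in the duality map at [x]. *)
Lemma norming_dual x : exists2 u : dual E, dnorm u <= `|x| & dapp u x = `|x| ^+ 2.
Proof.
have [| |||l [llin lN lx]] := @sandwich R E (fun x => `|x|)
  (fun y r => y = - x /\ r = - `|x|) norm_sublinear _ _ _ _.
- by move=> y; rewrite normrN.
- by exists (- x), (- `|x|).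
- move=> t _ _ _ _ _ [-> ->] [-> ->].
  by rewrite -scalerDl -mulrDl addrC subrK scale1r mul1r.
- by move=> _ _ [-> ->]; rewrite normrN addNr.
have lneg y : l (- y) = - l y.
  have l0 : l 0 = 0 by have := llin 1 0 0; rewrite scaler0 addr0 /= mul1r; lra.
  by have := llin 1 y (- y); rewrite scale1r subrr l0 /= mul1r; lra.
have lbd y : `|l y| <= 1 * `|y|.
  by rewrite mul1r ler_norml lN andbT -lerNl -lneg (le_trans (lN _)) ?normrN.
pose u : dual E := exist _ l (bounded_is_dual llin lbd).
have ux : dapp u x = `|x|.
  apply/le_anti; rewrite /dapp /= lN /=.
  by have := lx _ _ (conj erefl erefl); rewrite lneg lerN2.
exists (`|x| *: u); last by rewrite dualE ux.
apply: le_trans (dnormZ_le _ _) _; rewrite normr_id -[leRHS]mulr1.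
by rewrite ler_wpM2l // dnorm_le.
Qed.

End dual_module.

(** * Completeness and Baire category *)

Section limits.
Variable R : realType.

Lemma half_pow_lt (C e : R) : 0 < e -> exists n : nat, C / 2 ^+ n < e.
Proof.
move=> e0; pose n := Num.truncn (`|C| / e); exists n.+1.
rewrite ltr_pdivrMr ?exprn_gt0 // mulrC -ltr_pdivrMr //.
apply: (@le_lt_trans _ _ (`|C| / e)).
  by rewrite ler_pM2r ?invr_gt0 // ler_norm.
apply: (lt_trans (truncnS_gt _)).
by rewrite -natrX ltr_nat ltn_expl.
Qed.

(** The explicit rate [r] survives as an error bound for the limit, which the Baire and series
    arguments exploit. *)
Lemma cauchy_lim (E : completeNormedModType R) (x : nat -> E) (r : nat -> R) :
  (forall e : R, 0 < e -> exists n, r n < e) ->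
  (forall n m, (n <= m)%N -> `|x m - x n| <= r n) ->
  exists l, forall n, `|l - x n| <= r n.
Proof.
move=> r0 xr.
have /cauchy_cvgP xl : cauchy (x @ \oo).
  apply: cauchy_exP => e e0; have [N rN] := r0 e e0.
  exists (x N), N => // m Nm; rewrite /= -ball_normE /ball_ /= distrC.
  exact: le_lt_trans (xr _ _ Nm) rN.
exists (lim (x @ \oo)) => n; apply/ler_addgt0Pr => e e0.
have /cvgrPdist_lt /(_ e e0) [N _ xN] := xl.
have := xN (maxn N n) (leq_maxl _ _) => /= h1.
have h2 := xr n (maxn N n) (leq_maxr _ _).
rewrite -(subrK (x (maxn N n)) (lim _)) -addrA addrC.
by apply: le_trans (ler_normD _ _) _; apply: lerD => //; exact: ltW.
Qed.

(** The limit is taken pointwise in [R^o] with rate [r n * |x|]; this uniformity makes it a bounded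
    functional and the convergence one in [dnorm]. *)
Lemma dual_cauchy_lim (E : normedModType R) (u : nat -> dual E) (r : nat -> R) :
  (forall e : R, 0 < e -> exists n, r n < e) ->
  (forall n m, (n <= m)%N -> dnorm (u m - u n) <= r n) ->
  exists l : dual E, forall n, dnorm (l - u n) <= r n.
Proof.
move=> r0 ur.
have rge n : 0 <= r n by apply: le_trans (ur n n _) => //; exact: dnorm_ge0.
have small (a : R) C : 0 <= C -> (forall n, `|a| <= C * r n) -> a = 0.
  move=> C0 aC; apply/eqP; rewrite -normr_le0; apply/ler_addgt0Pr => e e0.
  have C1 : 0 < C + 1 by rewrite ltr_wpDl.
  have [n rn] := r0 (e / (C + 1)) (divr_gt0 e0 C1).
  rewrite add0r; apply: le_trans (aC n) _.
  move: rn; rewrite ltr_pdivlMr // => rn.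
  by have := rge n; nra.
have lim_ex (x : E) : exists l : R, forall n, `|l - dapp (u n) x| <= r n * `|x|.
  apply: (@cauchy_lim R^o (fun n => dapp (u n) x)) => [e e0|n m nm].
    have x1 : 0 < `|x| + 1 by rewrite ltr_wpDl.
    have [n rn] := r0 (e / (`|x| + 1)) (divr_gt0 e0 x1); exists n.
    move: rn; rewrite ltr_pdivlMr //; apply: le_lt_trans.
    by rewrite ler_wpM2l // lerDl.
  have -> : dapp (u m) x - dapp (u n) x = dapp (u m - u n) x by rewrite !dualE.
  by apply: le_trans (dapp_le_dnorm _ _) _; rewrite ler_wpM2r // ur.
have [l lu] := choice lim_ex.
have llin : linear_for *%R l.
  move=> a x y; apply/eqP; rewrite -subr_eq0; apply/eqP.
  apply: (small _ (`|a *: x + y| + `|a| * `|x| + `|y|)) => [|n].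
    by rewrite !addr_ge0 // mulr_ge0.
  have -> : l (a *: x + y) - (a * l x + l y) =
      (l (a *: x + y) - dapp (u n) (a *: x + y)) -
      (a * (l x - dapp (u n) x) + (l y - dapp (u n) y)).
    by rewrite dapp_linear; ring.
  apply: le_trans (ler_normB _ _) _.
  apply: le_trans (lerD (lexx _) (ler_normD _ _)) _.
  rewrite normrM mulrC.
  have := lu (a *: x + y) n; have := lu y n.
  have : `|a| * `|l x - dapp (u n) x| <= `|a| * (r n * `|x|).
    by rewrite ler_wpM2l // lu.
  by rewrite /=; lra.
have lbd x : `|l x| <= (dnorm (u 0%N) + r 0%N) * `|x|.
  rewrite -(subrK (dapp (u 0%N) x) (l x)).
  apply: le_trans (ler_normD _ _) _.
  rewrite mulrDl addrC; apply: lerD => //; exact: dapp_le_dnorm.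
exists (exist _ l (bounded_is_dual llin lbd)) => n.
by apply: dnorm_le => // x; rewrite !dualE; exact: lu.
Qed.

Lemma closed_norm (E : normedModType R) (F : set E) (l : E) : closed F ->
  (forall e : R, 0 < e -> exists2 y, F y & `|l - y| < e) -> F l.
Proof.
move=> cF lF; apply: cF => B /nbhs_ballP [e /= e0 eB].
have [y Fy ly] := lF e e0; exists y; split=> //; apply: eB.
by rewrite -ball_normE.
Qed.

(** If no [A n] were dense in a relative ball of [F], nested balls with halving radii could avoid
    each [A n] in turn, and their centres would converge to a point of [F] in no [A n]. *)
Lemma baire_closed (E : completeNormedModType R) (F : set E) (A : nat -> set E) :
  closed F -> F !=set0 -> (forall x, F x -> exists n, A n x) ->
  exists n x (e : R), [/\ F x, 0 < e & forall y, F y -> `|y - x| < e ->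
    forall d : R, 0 < d -> exists2 z, A n z & `|y - z| < d].
Proof.
move=> cF [x0 Fx0] FA; apply: contrapT => noA.
have step (p : nat * (E * R)) : exists q : E * R, F p.2.1 -> 0 < p.2.2 ->
    [/\ F q.1, 0 < q.2, q.2 <= p.2.2 / 2, `|q.1 - p.2.1| <= p.2.2 / 2 &
      forall z, A p.1 z -> q.2 < `|q.1 - z|].
  case: p => n [x e] /=.
  have [[Fx e0]|bad] := pselect (F x /\ 0 < e); last first.
    by exists (x, e) => Fx e0; case: bad.
  apply: contrapT => noq; apply: noA; exists n, x, (e / 2).
  split=> //; first by rewrite divr_gt0.
  move=> y Fy yx d d0; apply: contrapT => noz; apply: noq.
  (* [d / 2] makes the distance to [A n] strictly exceed the new radius; [e / 2] keeps the balls
     nested. *)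
  exists (y, Num.min (d / 2) (e / 2)) => _ _ /=.
  rewrite lt_min !divr_gt0 // ge_min lexx orbT (ltW yx); split=> // z Az.
  rewrite gt_min; apply/orP; left; apply: (@lt_le_trans _ _ d).
    by rewrite gtr_pMr // invf_lt1 // ltr1n.
  by rewrite leNgt; apply/negP => yz; apply: noz; exists z.
have {step} [st stP] := choice step.
pose s := fix s n := if n is n'.+1 then st (n', s n') else (x0, 1 : R).
have sP n : F (s n).1 /\ 0 < (s n).2.
  elim: n => [//|n [Fn en]] /=.
  by have [] := stP (n, s n) Fn en.
have sS n := stP (n, s n) (proj1 (sP n)) (proj2 (sP n)).
have s2 n : (s n).2 <= 1 / 2 ^+ n.
  elim: n => [|n IH]; first by rewrite expr0 divr1.
  have [_ _ /= h _ _] := sS n; apply: le_trans h _.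
  by rewrite exprSr invfM mulrA ler_pM2r // invr_gt0.
have sD n k : `|(s (n + k)%N).1 - (s n).1| <= (s n).2 - (s (n + k)%N).2.
  elim: k => [|k IH]; first by rewrite addn0 !subrr normr0.
  have [_ _ /= h1 h2 _] := sS (n + k)%N; rewrite addnS.
  rewrite -(subrK (s (n + k)%N).1 (s (n + k).+1).1) -addrA.
  by apply: le_trans (ler_normD _ _) _; rewrite /= in IH *; lra.
have [|n m nm|l lP] := @cauchy_lim E (fun n => (s n).1) (fun n => (s n).2).
- move=> e e0; have [n ne] := half_pow_lt 1 e0.
  by exists n; exact: le_lt_trans (s2 n) ne.
- rewrite -(subnKC nm); apply: le_trans (sD _ _) _.
  by rewrite gerBl ltW //; case: (sP (n + (m - n))%N).
have Fl : F l.
  apply: closed_norm => // e e0; have [n ne] := half_pow_lt 1 e0.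
  exists (s n).1; first by case: (sP n).
  exact: le_lt_trans (lP n) (le_lt_trans (s2 n) ne).
(* The ball that avoids [A n] is the one of index [n.+1], and it contains [l]. *)
have [n /= Anl] := FA l Fl.
have [_ _ _ _ /(_ l Anl)] := sS n; rewrite distrC.
by have := lP n.+1; rewrite leNgt => /negP.
Qed.

End limits.

(** Baire makes some [n C n] dense near a point [x0] of [F]. As [- x0] lies in some [m C m],
    averaging moves the centre to 0 without any symmetry of the sets. *)
Lemma absorbing_closure (R : realType) (E : completeNormedModType R)
    (F : set E) (C : nat -> set E) :
  closed_subspace F -> (forall n, C n 0) ->
  (forall n t x y, 0 <= t <= 1 -> C n x -> C n y -> C n (t *: x + (1 - t) *: y)) ->
  (forall n m, (n <= m)%N -> C n `<=` C m) ->
  (forall x, F x -> exists n c, C n c /\ x = n%:R *: c) ->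
  exists N (r : R), 0 < r /\ forall y, F y -> `|y| < r ->
    forall d : R, 0 < d -> exists2 c, C N c & `|y - c| < d.
Proof.
move=> [cF [F0 linF]] C0 convC monC FC.
pose A n := [set x | exists c, C n c /\ x = n%:R *: c].
have [||n [x0 [e [Fx0 e0 Ae]]]] := @baire_closed R E F A cF.
- by exists 0.
- by move=> x /FC [n [c [Cc ->]]]; exists n, c.
have [m [c' [Cc' x0c']]] : exists m c', C m c' /\ - x0 = m%:R *: c'.
  by apply: FC; have := linF (-1) _ _ Fx0 F0; rewrite scaleN1r addr0.
pose N := (maxn n m).+1; have N0 : 0 < N%:R :> R by rewrite ltr0n.
have NN : N%:R != 0 :> R by rewrite gt_eqF.
have scaleC k c : (k <= N)%N -> C k c -> C N ((k%:R / N%:R) *: c).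
  move=> kN Ckc.
  have := convC N (k%:R / N%:R) c 0; rewrite scaler0 addr0; apply => //.
    by rewrite divr_ge0 //= ler_pdivrMr // mul1r ler_nat.
  exact: monC kN _ Ckc.
exists N, (e / (2 * N%:R)); split; first by rewrite divr_gt0 // mulr_gt0.
move=> y Fy ye d d0.
have N2 : 0 < 2 * N%:R :> R by rewrite mulr_gt0.
have Fy' : F ((2 * N%:R) *: y + x0) by exact: linF.
have [||_ [c [Cc ->]]] := Ae _ Fy' _ (2 * N%:R * d).
- by rewrite addrK normrZ gtr0_norm // mulrC -ltr_pdivlMr.
- exact: mulr_gt0.
move=> dist.
(* [2 N y + x0] is close to [n c] and [- x0 = m c'], so [y] is close to [(n c + m c') / (2 N)]. *)
exists (2^-1 *: ((n%:R / N%:R) *: c) + (1 - 2^-1) *: ((m%:R / N%:R) *: c')).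
  apply: convC; first by rewrite invr_ge0 ler0n /= invf_le1 // ler1n.
    by apply: scaleC => //; rewrite ltnW // ltnS leq_maxl.
  by apply: scaleC => //; rewrite ltnW // ltnS leq_maxr.
rewrite -(ltr_pM2l N2) -[X in X * _ < _](gtr0_norm N2) -normrZ.
have -> // : (2 * N%:R) *: (y - (2^-1 *: ((n%:R / N%:R) *: c) +
    (1 - 2^-1) *: ((m%:R / N%:R) *: c'))) = (2 * N%:R) *: y + x0 - n%:R *: c.
have -> : n%:R *: c = (2 * N%:R) *: (2^-1 *: ((n%:R / N%:R) *: c)).
  by rewrite !scalerA; congr (_ *: _); field.
have -> : x0 = - ((2 * N%:R) *: ((1 - 2^-1) *: ((m%:R / N%:R) *: c'))).
  by rewrite -[LHS]opprK x0c' !scalerA; congr (- (_ *: _)); field.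
by rewrite scalerBr scalerDr opprD addrA addrAC.
Qed.

(** * Convex series in sublevel sets *)

Section sublevel_sets.
Variables (R : realType) (E : completeNormedModType R).
Implicit Types (k : E * dual E -> \bar R) (M : R) (z w : E * dual E).

Lemma convex_fun_le k (t r s : R) z w : convex_fun k -> 0 <= t <= 1 ->
  (k z <= r%:E)%E -> (k w <= s%:E)%E ->
  (k (t *: z + (1 - t) *: w)%R <= (t * r + (1 - t) * s)%:E)%E.
Proof.
move=> convk /andP[]; rewrite le_eqVlt => /orP[/eqP <- _ _ ws|t0].
  by rewrite subr0 !scale0r !scale1r add0r mul0r mul1r add0r.
rewrite le_eqVlt => /orP[/eqP -> zr _|t1 zr ws].
  by rewrite subrr !scale0r !scale1r addr0 mul0r mul1r addr0.
apply: le_trans (convk t z w (t *: z + (1 - t) *: w).2 _ _) _ => //.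
  by rewrite t0.
by rewrite [leRHS]EFinD !EFinM; apply: leeD; apply: lee_wpmul2l => //;
   rewrite lee_fin ?subr_ge0 ltW.
Qed.

Definition sublevel k M : set (E * dual E) :=
  [set z | [/\ `|z.1| <= M, dnorm z.2 <= M & (k z <= M%:E)%E]].

Lemma sublevel_convex k M t z w : convex_fun k -> 0 <= t <= 1 ->
  sublevel k M z -> sublevel k M w -> sublevel k M (t *: z + (1 - t) *: w).
Proof.
move=> convk t01 [z1 z2 kz] [w1 w2 kw]; have /andP[t0 t1] := t01.
have t1' : 0 <= 1 - t by rewrite subr_ge0.
have MM : t * M + (1 - t) * M = M by ring.
split; last by rewrite -[leRHS]/(M%:E) -MM; exact: convex_fun_le.
  apply: le_trans (ler_normD _ _) _.
  by rewrite !normrZ !ger0_norm // -MM lerD // ler_wpM2l.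
apply: le_trans (dnormD _ _) _.
rewrite -MM lerD //; apply: le_trans (dnormZ_le _ _) _;
by rewrite ger0_norm // ler_wpM2l.
Qed.

Lemma sublevel_mono k M M' : M <= M' -> sublevel k M `<=` sublevel k M'.
Proof.
move=> MM z [z1 z2 kz]; split; [exact: le_trans MM|exact: le_trans MM|].
by apply: le_trans kz _; rewrite lee_fin.
Qed.

Lemma sublevel_closed k M (z : nat -> E * dual E) w : lsc_fun k ->
  (forall n, sublevel k M (z n)) ->
  (forall e : R, 0 < e ->
     exists n, `|w.1 - (z n).1| < e /\ dnorm (w.2 - (z n).2) < e) ->
  sublevel k M w.
Proof.
move=> lsck Mz zw; split.
- apply/ler_addgt0Pr => e e0; have [n [h _]] := zw e e0; have [zM _ _] := Mz n.
  rewrite -(subrK (z n).1 w.1) addrC; apply: le_trans (ler_normD _ _) _.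
  by rewrite lerD // ltW.
- apply/ler_addgt0Pr => e e0; have [n [_ h]] := zw e e0; have [_ zM _] := Mz n.
  rewrite -(subrK (z n).2 w.2) addrC; apply: le_trans (dnormD _ _) _.
  by rewrite lerD // ltW.
rewrite leNgt; apply/negP => /lsck [e e0 kgt].
have [n [h1 h2]] := zw e e0; have [_ _] := Mz n.
rewrite leNgt => /negP; apply; apply: kgt; first by rewrite distrC.
move=> v vE; rewrite -dnormN.
suff -> : - v = w.2 - (z n).2 by [].
by apply: dual_ext => x; rewrite !dualE vE opprB.
Qed.

(** The exponent [i.+1] makes the weights sum to 1: the full series is an infinite convex
    combination, and [n] terms leave the weight [2^-n]. *)
Definition half_series (V : lmodType R) (P : nat -> V) (n : nat) : V :=
  \sum_(i < n) (2^-1 ^+ i.+1) *: P i.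

Lemma half_seriesS (V : lmodType R) (P : nat -> V) n :
  half_series P n.+1 = half_series P n + 2^-1 ^+ n.+1 *: P n.
Proof. by rewrite /half_series big_ord_recr. Qed.

Lemma half_series_fst (P : nat -> E * dual E) n :
  (half_series P n).1 = half_series (fst \o P) n.
Proof.
elim: n => [|n IH]; first by rewrite /half_series !big_ord0.
by rewrite !half_seriesS /= IH.
Qed.

(* [p] stands for the norm of [E] or of its dual. *)
Lemma half_series_cauchy (V : lmodType R) (p : V -> R) (P : nat -> V) M :
  sublinear p -> 0 <= M -> (forall n, p (P n) <= M) ->
  forall n m, (n <= m)%N -> p (half_series P m - half_series P n) <= M * 2^-1 ^+ n.
Proof.
move=> slp M0 PM n m nm; rewrite -(subnKC nm).
suff : p (half_series P (n + (m - n)) - half_series P n) <=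
    M * (2^-1 ^+ n - 2^-1 ^+ (n + (m - n))).
  move=> /le_trans; apply; rewrite ler_wpM2l // gerBl.
  by rewrite exprn_ge0 // invr_ge0.
elim: (m - n)%N => [|j IH].
  by rewrite addn0 !subrr mulr0 sublinear0.
rewrite addnS half_seriesS addrAC; have [pD pZ] := slp.
apply: le_trans (pD _ _) _.
have c0 : 0 < 2^-1 ^+ (n + j).+1 :> R by rewrite exprn_gt0 // invr_gt0.
have h : 2^-1 ^+ (n + j).+1 * p (P (n + j)%N) <= 2^-1 ^+ (n + j).+1 * M.
  by rewrite ler_pM2l.
have := pZ _ (P (n + j)%N) c0.
have : 2^-1 ^+ (n + j) = 2 * 2^-1 ^+ (n + j).+1 :> R.
  by rewrite exprS mulrA mulfV // mul1r.
by move: IH h; set u := _ ^+ (n + j); set v := _ ^+ _.+1; nra.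
Qed.

(** Giving the missing weight [2^-n] to any point of the sublevel set turns a partial sum into a
    convex combination; closedness then reaches the limit. *)
Lemma sublevel_half_series k M (P : nat -> E * dual E) :
  convex_fun k -> lsc_fun k -> 0 <= M -> (forall n, sublevel k M (P n)) ->
  exists2 z, sublevel k M z & forall n,
    `|z.1 - half_series (fst \o P) n| <= M / 2 ^+ n.
Proof.
move=> convk lsck M0 MP; pose S := half_series P.
have partial n z : sublevel k M z -> sublevel k M (S n + 2^-1 ^+ n *: z).
  elim: n z => [|n IH] z Mz.
    by rewrite /S /half_series big_ord0 add0r expr0 scale1r.
  have /IH : sublevel k M (2^-1 *: P n + (1 - 2^-1) *: z).
    apply: sublevel_convex => //.
    by rewrite invr_ge0 ler0n /= invf_le1 // ler1n.
  rewrite scalerDr !scalerA addrA -exprSr -half_seriesS.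
  have -> : 1 - 2^-1 = 2^-1 :> R by field.
  by rewrite -exprSr.
have M2 (e : R) : 0 < e -> exists n, M * 2^-1 ^+ n < e.
  by move=> /(half_pow_lt M) [n]; rewrite -exprVn; exists n.
have [|x xS] := @cauchy_lim R E (fun n => (S n).1) (fun n => M * 2^-1 ^+ n) M2.
  move=> n m nm; rewrite !half_series_fst.
  by apply: (half_series_cauchy (@norm_sublinear R E)) => // i; case: (MP i).
have S2 n : (S n).2 = half_series (snd \o P) n.
  elim: n => [|n IH]; first by rewrite /S /half_series !big_ord0.
  by rewrite /S !half_seriesS /= -IH.
have [|u uS] := @dual_cauchy_lim R E (fun n => (S n).2) (fun n => M * 2^-1 ^+ n) M2.
  move=> n m nm; rewrite !S2.
  by apply: (half_series_cauchy (@dnorm_sublinear R E)) => // i; case: (MP i).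
exists (x, u); last by move=> n; rewrite -half_series_fst -exprVn.
apply: (sublevel_closed (z := fun n => S n + 2^-1 ^+ n *: P 0%N)) => //.
  by move=> n; exact: partial.
move=> e e0; have [n ne] := M2 (e / 2) (divr_gt0 e0 (ltr0Sn _ 1)).
have [P1 P2 _] := MP 0%N.
have c0 : 0 <= 2^-1 ^+ n :> R by rewrite exprn_ge0 // invr_ge0.
exists n; split=> /=; rewrite opprD addrA.
  apply: le_lt_trans (ler_normB _ _) _; rewrite normrZ ger0_norm //.
  have := xS n; have : 2^-1 ^+ n * `|(P 0%N).1| <= 2^-1 ^+ n * M.
    by rewrite ler_wpM2l.
  by rewrite /=; lra.
apply: le_lt_trans (dnormD _ _) _; rewrite dnormN.
apply: le_lt_trans (lerD (lexx _) (dnormZ_le _ _)) _; rewrite ger0_norm //.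
have := uS n; have : 2^-1 ^+ n * dnorm (P 0%N).2 <= 2^-1 ^+ n * M.
  by rewrite ler_wpM2l.
by rewrite /=; lra.
Qed.

End sublevel_sets.

(** * Attouch-Brezis: differences of bounded sublevel sets *)

Lemma pi1_dom_le (R : realType) (E : normedModType R)
    (k : E * dual E -> \bar R) z (r : R) :
  proper_fun k -> (k z <= r%:E)%E -> pi1_dom k z.1.
Proof.
move=> [kNoo _] kr; exists z.2; rewrite -surjective_pairing.
by rewrite fin_numE kNoo /= -ltey (le_lt_trans kr) // ltey.
Qed.

Section sublevel_difference.
Variables (R : realType) (E : completeNormedModType R).
Variables f g : E * dual E -> \bar R.
Hypotheses (propf : proper_fun f) (convf : convex_fun f) (lscf : lsc_fun f).
Hypotheses (propg : proper_fun g) (convg : convex_fun g) (lscg : lsc_fun g).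

Let F : set E := [set y : E | exists (l : R) (a b : E),
  0 < l /\ pi1_dom f a /\ pi1_dom g b /\ y = l *: (a - b)].

Hypothesis subF : closed_subspace F.

Lemma fin_num_sublevel (k : E * dual E -> \bar R) z : k z \is a fin_num ->
  exists2 M : R, 0 <= M & sublevel k M z.
Proof.
move=> kz; have d0 := dnorm_ge0 z.2.
exists (`|z.1| + dnorm z.2 + `|fine (k z)|); first by rewrite !addr_ge0.
split; first by rewrite -addrA lerDl addr_ge0.
  by rewrite addrAC lerDr addr_ge0.
rewrite -(fineK kz) lee_fin; apply: le_trans (ler_norm _) _.
by rewrite fineK // lerDr addr_ge0.
Qed.

Let C M : set E := [set d | exists z w,
  [/\ sublevel f M z, sublevel g M w & d = z.1 - w.1]].

Lemma sublevel_difference_sub M : C M `<=` F.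
Proof.
move=> _ [z [w [fz gw ->]]]; exists 1, z.1, w.1.
have [_ _ fzM] := fz; have [_ _ gwM] := gw.
split=> //; split; first exact: pi1_dom_le fzM.
by split; [exact: pi1_dom_le gwM|rewrite scale1r].
Qed.

Lemma sublevel_difference_convex M t d e : 0 <= t <= 1 ->
  C M d -> C M e -> C M (t *: d + (1 - t) *: e).
Proof.
move=> t01 [z [w [fz gw ->]]] [z' [w' [fz' gw' ->]]].
exists (t *: z + (1 - t) *: z'), (t *: w + (1 - t) *: w').
split; [exact: sublevel_convex|exact: sublevel_convex|].
by rewrite /= !scalerBr opprD addrACA.
Qed.

Lemma sublevel_difference_mono M M' : M <= M' -> C M `<=` C M'.
Proof.
move=> MM _ [z [w [fz gw ->]]]; exists z, w.
by split=> //; exact: sublevel_mono MM _ _.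
Qed.

Lemma sublevel_difference_closure : exists M r : R, [/\ 0 <= M, 0 < r &
  forall y, F y -> `|y| < r -> forall d : R, 0 < d ->
    exists2 c, C M c & `|y - c| < d].
Proof.
have [l0 [a0 [b0 [l00 [[al0 fa0] [[be0 gb0] ab0]]]]]] : F 0 by case: subF => _ [].
have {ab0} ab0 : a0 - b0 = 0.
  by apply/eqP; move/esym/eqP: ab0; rewrite scaler_eq0 gt_eqF.
have [M1 M10 fM1] := fin_num_sublevel fa0.
have [M2 M20 gM2] := fin_num_sublevel gb0.
(* Since 0 is in [F], the two projections share the point [a0 = b0]; starting the levels at [M0]
   puts 0 in every [C (M0 + n%:R)]. *)
pose M0 := M1 + M2; have M00 : 0 <= M0 by rewrite addr_ge0.
have C0 n : C (M0 + n%:R) 0.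
  exists (a0, al0), (b0, be0); split; last by rewrite ab0.
    by apply: sublevel_mono fM1; rewrite -addrA lerDl addr_ge0.
  by apply: sublevel_mono gM2; rewrite addrAC lerDr addr_ge0.
have [|||||N [r [r0 Nr]]] := @absorbing_closure R E F (fun n => C (M0 + n%:R)).
- exact: subF.
- exact: C0.
- by move=> n t x y; exact: sublevel_difference_convex.
- by move=> n m nm; apply: sublevel_difference_mono; rewrite lerD2l ler_nat.
- move=> _ [l [a [b [l0' [[al fa] [[be gb] ->]]]]]].
  have [Ma Ma0 fMa] := fin_num_sublevel fa.
  have [Mb Mb0 gMb] := fin_num_sublevel gb.
  (* [n] exceeds [l], so that [(l / n) (a - b)] is a convex combination of [a - b] and 0, and
     exceeds the levels [Ma] and [Mb]. *)
  pose n := (Num.truncn (l + Ma + Mb)).+1.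
  have nlt : l + Ma + Mb < n%:R by exact: truncnS_gt.
  have n0 : 0 < n%:R :> R by rewrite ltr0n.
  exists n, ((l / n%:R) *: (a - b)); split.
    rewrite -[_ *: _]addr0 -(scaler0 _ (1 - l / n%:R)).
    apply: sublevel_difference_convex => //.
      by rewrite divr_ge0 ?(ltW l0') //= ler_pdivrMr // mul1r; lra.
    exists (a, al), (b, be); split=> //.
      by apply: sublevel_mono fMa; lra.
    by apply: sublevel_mono gMb; lra.
  by rewrite scalerA mulrC divfK // gt_eqF.
by exists (M0 + N%:R), r; split=> //; rewrite addr_ge0.
Qed.

(* As in the open mapping theorem: a small [d] in [F] is the sum of a series
   [sum_n 2^-(n+1) (a_n - b_n)], and the sublevel sets contain the sums of
   the corresponding convex series because [f] and [g] are lsc. *)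
Lemma sublevel_difference_ball : exists M r : R, [/\ 0 <= M, 0 < r &
  forall d, F d -> `|d| < r -> C M d].
Proof.
have [M [r [M0 r0 Mr]]] := sublevel_difference_closure.
have [_ [_ linF]] := subF.
have r2 : 0 < r / 2 by rewrite divr_gt0.
exists M, (r / 2); split=> // d Fd dr.
have pick e : exists zw, F e -> `|e| < r / 2 ->
    [/\ sublevel f M zw.1, sublevel g M zw.2 &
      `|2 *: e - (zw.1.1 - zw.2.1)| < r / 2].
  have [[Fe er]|bad] := pselect (F e /\ `|e| < r / 2); last first.
    by exists (0, 0) => Fe er; case: bad.
  have [||_ [z [w [fz gw ->]]] ezw] := Mr (2 *: e) _ _ _ r2.
  - by have := linF 1 _ _ Fe Fe; rewrite scale1r scaler_nat mulr2n.
  - by rewrite normrZ gtr0_norm // mulrC -ltr_pdivlMr.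
  by exists (z, w).
have [p pP] := choice pick.
(* [e n] is the remainder after [n] terms multiplied by [2^n]; [pick] returns it to the ball of
   radius [r / 2] after each doubling. *)
pose e := fix e n := if n is n'.+1
  then 2 *: e n' - ((p (e n')).1.1 - (p (e n')).2.1) else d.
have eP n : F (e n) /\ `|e n| < r / 2.
  elim: n => [//|n [Fe er]]; have [fz gw h] := pP _ Fe er; split=> //=.
  have Fc : F ((p (e n)).1.1 - (p (e n)).2.1).
    by apply: (@sublevel_difference_sub M); exists (p (e n)).1, (p (e n)).2.
  rewrite addrC -scaleN1r; apply: (linF (-1)) => //.
  by have := linF 1 _ _ Fe Fe; rewrite scale1r scaler_nat mulr2n.
have pf n : sublevel f M (p (e n)).1 by have [? ?] := eP n; case: (pP (e n)).
have pg n : sublevel g M (p (e n)).2 by have [? ?] := eP n; case: (pP (e n)).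
have [z fz zS] := sublevel_half_series convf lscf M0 pf.
have [w gw wS] := sublevel_half_series convg lscg M0 pg.
exists z, w; split=> //.
have dS n : d = half_series (fst \o (fun n => (p (e n)).1)) n -
    half_series (fst \o (fun n => (p (e n)).2)) n + 2^-1 ^+ n *: e n.
  elim: n => [|n IH].
    by rewrite /half_series !big_ord0 subrr add0r expr0 scale1r.
  have e2 : 2^-1 ^+ n *: e n = 2^-1 ^+ n.+1 *: (2 *: e n).
    by rewrite scalerA exprSr -mulrA mulVf ?mulr1.
  rewrite [LHS]IH e2 !half_seriesS /= [in RHS]opprD [in RHS]addrACA -[RHS]addrA.
  by rewrite -scalerBr -scalerDr [X in _ = _ + _ *: X]addrC subrK.
apply/eqP; rewrite -subr_eq0 -normr_le0; apply/ler_addgt0Pr => x x0.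
rewrite add0r; have [n ne] := half_pow_lt (2 * M + r / 2) x0.
apply: le_trans (ltW ne).
have := zS n; have := wS n; rewrite [in `|d - _|](dS n).
set Sg := half_series _ _; set Sf := half_series _ _ => h1 h2.
have -> : Sf - Sg + 2^-1 ^+ n *: e n - (z.1 - w.1) =
    (w.1 - Sg) - (z.1 - Sf) + 2^-1 ^+ n *: e n.
  rewrite !opprB addrAC; congr (_ + _).
  by rewrite addrACA [RHS]addrACA; congr (_ + _); rewrite addrC.
have c0 : 0 <= 2^-1 ^+ n :> R by rewrite exprn_ge0 // invr_ge0.
apply: le_trans (ler_normD _ _) _.
apply: le_trans (lerD (ler_normB _ _) (lexx _)) _.
rewrite normrZ ger0_norm // mulrDl -exprVn.
have [_ /ltW er] := eP n.
have : 2^-1 ^+ n * `|e n| <= 2^-1 ^+ n * (r / 2) by rewrite ler_wpM2l.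
by move: h1 h2; rewrite -exprVn; lra.
Qed.

End sublevel_difference.

(** * Duality *)

Lemma sqr_convex (R : realFieldType) (t a b c : R) :
  0 <= t <= 1 -> 0 <= c -> c <= t * a + (1 - t) * b ->
  c ^+ 2 <= t * a ^+ 2 + (1 - t) * b ^+ 2.
Proof.
move=> /andP[t0 t1] c0 cab.
have : c ^+ 2 <= (t * a + (1 - t) * b) ^+ 2.
  by rewrite ler_sqr ?nnegrE // (le_trans c0).
have : 0 <= t * (1 - t) * (a - b) ^+ 2.
  by rewrite mulr_ge0 ?sqr_ge0 // mulr_ge0 // subr_ge0.
have -> : t * (1 - t) * (a - b) ^+ 2 =
   t * a ^+ 2 + (1 - t) * b ^+ 2 - (t * a + (1 - t) * b) ^+ 2 by ring.
lra.
Qed.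

Lemma comb_affine (R : realType) (V : lmodType R) (t : R) (a b a' b' d : V) :
  t *: (a + b - d) + (1 - t) *: (a' + b' - d) =
  t *: a + (1 - t) *: a' + (t *: b + (1 - t) *: b') - d.
Proof.
have dE : d = t *: d + (1 - t) *: d by rewrite -scalerDl addrC subrK scale1r.
rewrite [in RHS]dE !scalerDr !scalerN opprD addrACA.
by rewrite [X in X + _ = _]addrACA.
Qed.

Section duality.
Variables (R : realType) (E : completeNormedModType R).
Variables f g : E * dual E -> \bar R.
Hypotheses (propf : proper_fun f) (convf : convex_fun f) (lscf : lsc_fun f).
Hypotheses (propg : proper_fun g) (convg : convex_fun g) (lscg : lsc_fun g).
Hypotheses (qlef : forall z, ((qf z)%:E <= f z)%E)
           (qleg : forall z, ((qf z)%:E <= g z)%E).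
Hypothesis subF : closed_subspace [set y : E | exists (l : R) (a b : E),
  0 < l /\ pi1_dom f a /\ pi1_dom g b /\ y = l *: (a - b)].
Variables (y : E) (ys : dual E).

Let X := (dual E * E * E)%type.

(* With [V] the marginal function [V u = inf {r | perturbation u r}], a
   subgradient [(x, s, t)] of [V] at [0] solves the dual problem. *)
Definition perturbation (u : X) (r : R) : Prop :=
  exists (z w : E * dual E) (ga : dual E) (c : E) (r1 r2 : R),
  [/\ (f z <= r1%:E)%E, (g w <= r2%:E)%E,
   u = (z.2 + w.2 + ga - ys, z.1 + c - y, w.1 + c - y) &
   r1 + r2 + dapp ga y + dapp ys c - dapp ys y +
     (dnorm ga ^+ 2 + `|c| ^+ 2) / 2 <= r].

Let nrm (u : X) : R := dnorm u.1.1 + `|u.1.2| + `|u.2|.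

Lemma nrm_sublinear : sublinear nrm.
Proof.
rewrite /nrm; split=> [u v|t u t0] /=.
  have := dnormD u.1.1 v.1.1; have := ler_normD u.1.2 v.1.2.
  by have := ler_normD u.2 v.2; lra.
rewrite !normrZ gtr0_norm // !mulrDr !lerD2r.
by apply: le_trans (dnormZ_le _ _) _; rewrite gtr0_norm.
Qed.

Lemma nrmN u : nrm (- u) = nrm u.
Proof. by rewrite /nrm /= dnormN !normrN. Qed.

Lemma nrm_ge0 u : 0 <= nrm u.
Proof. by rewrite /nrm !addr_ge0 // dnorm_ge0. Qed.

Lemma nrm_eq0 u : nrm u = 0 -> u = 0.
Proof.
case: u => [[u v] w]; rewrite /nrm /= => h.
have [hu hv hw] : [/\ dnorm u <= 0, `|v| <= 0 & `|w| <= 0].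
  by have := dnorm_ge0 u; have := normr_ge0 v; have := normr_ge0 w; split; lra.
move: hv hw; rewrite !normr_le0 => /eqP -> /eqP ->; congr (_, _, _).
apply: dual_ext => x; rewrite dualE; apply/eqP; rewrite -normr_le0.
apply: le_trans (dapp_le_dnorm _ _) _.
by rewrite mulr_le0_ge0.
Qed.

Lemma perturbation_convex t u v r s : 0 <= t <= 1 ->
  perturbation u r -> perturbation v s ->
  perturbation (t *: u + (1 - t) *: v) (t * r + (1 - t) * s).
Proof.
move=> t01 [z [w [ga [c [r1 [r2 [fz gw -> ru]]]]]]].
move=> [z' [w' [ga' [c' [s1 [s2 [fz' gw' -> sv]]]]]]].
have /andP[t0 t1] := t01; have t1' : 0 <= 1 - t by rewrite subr_ge0.
exists (t *: z + (1 - t) *: z'), (t *: w + (1 - t) *: w').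
exists (t *: ga + (1 - t) *: ga'), (t *: c + (1 - t) *: c').
exists (t * r1 + (1 - t) * s1), (t * r2 + (1 - t) * s2).
split; [exact: convex_fun_le|exact: convex_fun_le| |].
  congr (_, _, _) => /=; rewrite comb_affine //; congr (_ + _ - _).
  by rewrite !scalerDr addrACA.
have := sqr_convex t01 (dnorm_ge0 (t *: ga + (1 - t) *: ga')).
move=> /(_ (dnorm ga) (dnorm ga')) hga.
have := sqr_convex t01 (normr_ge0 (t *: c + (1 - t) *: c')).
move=> /(_ `|c| `|c'|) hc.
have {}hga := hga _; have {}hc := hc _.
have {hga} hga : dnorm (t *: ga + (1 - t) *: ga') ^+ 2 <=
    t * dnorm ga ^+ 2 + (1 - t) * dnorm ga' ^+ 2.
  apply: hga; apply: le_trans (dnormD _ _) _.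
  apply: lerD; apply: le_trans (dnormZ_le _ _) _;
  by rewrite ger0_norm.
have {hc} hc : `|t *: c + (1 - t) *: c'| ^+ 2 <=
    t * `|c| ^+ 2 + (1 - t) * `|c'| ^+ 2.
  apply: hc; apply: le_trans (ler_normD _ _) _.
  by rewrite !normrZ !ger0_norm.
rewrite !dualE dappD !dappZ.
have : t * (r1 + r2 + dapp ga y + dapp ys c - dapp ys y +
  (dnorm ga ^+ 2 + `|c| ^+ 2) / 2) <= t * r by rewrite ler_wpM2l.
have : (1 - t) * (s1 + s2 + dapp ga' y + dapp ys c' - dapp ys y +
  (dnorm ga' ^+ 2 + `|c'| ^+ 2) / 2) <= (1 - t) * s by rewrite ler_wpM2l.
lra.
Qed.

(** Zero perturbation means [z.1 = w.1 = y - c] and [z.2 + w.2 = ys - ga]. By [f, g >= q] the value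
    is at least [<c, ga> + (|ga|^2 + |c|^2) / 2], which is nonnegative. *)
Lemma perturbation0_ge0 r : perturbation 0 r -> 0 <= r.
Proof.
move=> [[a al] [[b be] [ga [c [r1 [r2 [/= fz gw uE hr]]]]]]].
have h1 : al + be + ga = ys.
  by apply/eqP; rewrite -subr_eq0; apply/eqP; exact: esym (congr1 (fst \o fst) uE).
have h2 : a = y - c.
  by apply/eqP; rewrite eq_sym subr_eq -subr_eq0 -oppr_eq0 opprB;
  apply/eqP; exact: esym (congr1 (snd \o fst) uE).
have h3 : b = y - c.
  by apply/eqP; rewrite eq_sym subr_eq -subr_eq0 -oppr_eq0 opprB;
  apply/eqP; exact: esym (congr1 snd uE).
have hf : dapp al a <= r1 by rewrite -lee_fin; exact: le_trans (qlef (a, al)) fz.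
have hg : dapp be b <= r2 by rewrite -lee_fin; exact: le_trans (qleg (b, be)) gw.
have hc : - (dnorm ga * `|c|) <= dapp ga c.
  by have := dapp_le_dnorm ga c; rewrite ler_norml => /andP[].
have : 0 <= (dnorm ga - `|c|) ^+ 2 by exact: sqr_ge0.
move: hf hg hr; rewrite h2 h3 -h1 !dualE !dappB sqrrB; lra.
Qed.

(** The shift [c - y] cancels in the difference, so feasible perturbations are restricted to
    directions of [F]. *)
Lemma perturbation_difference u r : perturbation u r ->
  exists z w (r1 r2 : R), [/\ (f z <= r1%:E)%E, (g w <= r2%:E)%E &
    u.2 - u.1.2 = w.1 - z.1].
Proof.
move=> [z [w [ga [c [r1 [r2 [fz gw -> _]]]]]]].
exists z, w, r1, r2; split=> //=.
by rewrite opprB addrA subrK opprD addrACA subrr addr0.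
Qed.

Let F : set E := [set y : E | exists (l : R) (a b : E),
  0 < l /\ pi1_dom f a /\ pi1_dom g b /\ y = l *: (a - b)].

Lemma perturbation_bounded : exists M rho : R, [/\ 0 <= M, 0 < rho &
  forall u, F (u.2 - u.1.2) -> nrm u < rho -> perturbation u M].
Proof.
have [M [rho [M0 rho0 Mball]]] :=
  sublevel_difference_ball propf convf lscf propg convg lscg subF.
pose B := 2 * M + rho + dnorm ys + `|y|.
have y0 := normr_ge0 y; have ys0 := dnorm_ge0 ys.
have B0 : 0 <= B by rewrite /B; lra.
exists (2 * M + B * `|y| + dnorm ys * B + dnorm ys * `|y| + B ^+ 2), rho.
split=> //; first by rewrite !addr_ge0 ?mulr_ge0 ?sqr_ge0.
move=> [[u v] w] /= Fu; rewrite /nrm /= => nu.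
have u0 := dnorm_ge0 u; have v0 := normr_ge0 v; have w0 := normr_ge0 w.
have [||p [p' [fp gp' pp']]] := Mball (v - w).
- have [_ [F0 linF]] := subF.
  by have := linF (-1) _ _ Fu F0; rewrite addr0 scaleN1r opprB.
- by apply: le_lt_trans (ler_normB _ _) _; lra.
have [p1 p2 fpM] := fp; have [p1' p2' gpM] := gp'.
(* The first two components determine [ga] and [c]; the third then holds by [p.1 - p'.1 = v - w].
   [B] bounds both norms. *)
exists p, p', (u - p.2 - p'.2 + ys), (v - p.1 + y), M, M; split=> //.
  congr (_, _, _).
  - by apply: dual_ext => x; rewrite !dualE; ring.
  - by rewrite /= addrA addrK addrC subrK.
  by rewrite /= addrA addrK addrCA -opprB -pp' subKr.
set ga := _ + ys; set c := _ + y.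
have gaB : dnorm ga <= B.
  rewrite /ga; have := dnormD (u - p.2 - p'.2) ys.
  have := dnormD (u - p.2) (- p'.2); have := dnormD u (- p.2).
  by rewrite !dnormN /B; lra.
have cB : `|c| <= B.
  rewrite /c; have := ler_normD (v - p.1) y.
  by have := ler_normB v p.1; rewrite /B; lra.
have ga0 := dnorm_ge0 ga; have c0 := normr_ge0 c.
have h1 : dapp ga y <= B * `|y|.
  apply: le_trans (ler_norm _) _; apply: le_trans (dapp_le_dnorm _ _) _.
  by rewrite ler_wpM2r.
have h2 : dapp ys c <= dnorm ys * B.
  apply: le_trans (ler_norm _) _; apply: le_trans (dapp_le_dnorm _ _) _.
  by rewrite ler_wpM2l.
have h3 : - (dnorm ys * `|y|) <= dapp ys y.
  by have := dapp_le_dnorm ys y; rewrite ler_norml => /andP[].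
have h4 : dnorm ga ^+ 2 <= B ^+ 2 by rewrite ler_sqr.
have h5 : `|c| ^+ 2 <= B ^+ 2 by rewrite ler_sqr.
lra.
Qed.

(** 0 lies between [u] and [- k u], where [k] gives the latter norm [rho / 2] and hence value at
    most [M]. Convexity and nonnegativity at 0 yield [r >= - M / k], so [K = 2 M / rho]. *)
Lemma perturbation_lower_bound : exists2 K : R, 0 <= K &
  forall u r, perturbation u r -> 0 <= r + K * nrm u.
Proof.
have [M [rho [M0 rho0 Mball]]] := perturbation_bounded.
exists (2 * M / rho) => [|u r ur]; first by rewrite divr_ge0 // ?mulr_ge0 // ltW.
have [/nrm_eq0 u0|nu] := eqVneq (nrm u) 0.
  rewrite u0 /nrm /= dnorm0 !normr0 !addr0 mulr0 addr0.
  by apply: perturbation0_ge0; rewrite -u0.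
have {nu} nu : 0 < nrm u by rewrite lt_neqAle eq_sym nu nrm_ge0.
pose k := rho / 2 / nrm u; have k0 : 0 < k by rewrite /k !divr_gt0.
have kN1 : k + 1 != 0 by rewrite gt_eqF // addr_gt0.
have : perturbation (- (k *: u)) M.
  apply: Mball; last first.
    rewrite nrmN sublinearZ //; last exact: nrm_sublinear.
    by rewrite /k divfK ?gt_eqF // ltr_pdivrMr // mulr_natr mulr2n; lra.
  have [z [w [r1 [r2 [fz gw uE]]]]] := perturbation_difference ur.
  exists k, z.1, w.1; split=> //; split; first exact: pi1_dom_le fz.
  split; first exact: pi1_dom_le gw.
  by rewrite /= -opprD -scalerBr -[z.1 - w.1]opprB -uE scalerN.
pose t := k / (k + 1).
have t01 : 0 <= t <= 1.
  have k1 : 0 < k + 1 by rewrite addr_gt0.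
  by rewrite /t ler_pdivrMr // mul1r lerDl ler01 andbT divr_ge0 // ltW.
move=> /(perturbation_convex t01 ur).
have -> : t *: u + (1 - t) *: - (k *: u) = 0.
  rewrite scalerN scalerA -scalerBl.
  have -> : t - (1 - t) * k = 0 by rewrite /t; field.
  by rewrite scale0r.
move=> /perturbation0_ge0.
have -> : t * r + (1 - t) * M = (k * r + M) / (k + 1) by rewrite /t; field.
rewrite pmulr_lge0 ?invr_gt0 ?addr_gt0 // => h.
have : 0 <= (k * r + M) / k by rewrite divr_ge0 // ltW.
have -> : (k * r + M) / k = r + M / k by field; rewrite gt_eqF.
suff -> : M / k = 2 * M / rho * nrm u by [].
by rewrite /k; field; rewrite !gt_eqF.
Qed.

(** The sandwich theorem with [K * nrm] gives a bounded linear minorant on [X]. Its restrictions to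
    the two copies of [E] are [s] and [t]; reflexivity represents the one to [dual E] by [x]. *)
Lemma perturbation_subgradient : reflexive_space E ->
  exists (x : E) (s t : dual E), forall u r, perturbation u r ->
    dapp u.1.1 x + dapp s u.1.2 + dapp t u.2 <= r.
Proof.
move=> reflE; have [K K0 Kle] := perturbation_lower_bound.
have slK : sublinear (fun u : X => K * nrm u).
  have [nD nZ] := nrm_sublinear; split=> [u v|t u t0].
    by rewrite -mulrDr ler_wpM2l.
  by rewrite mulrCA ler_wpM2l // nZ.
have [||||l [llin lK lle]] := @sandwich R X _ perturbation slK.
- by move=> u; rewrite nrmN.
- have [z fz] := propf.2; have [w gw] := propg.2.
  do 2!eexists; exists z, w, 0, 0, (fine (f z)), (fine (g w)).
  by split; [rewrite fineK|rewrite fineK| |exact: lexx].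
- move=> t u v r s /andP[t0 t1]; apply: perturbation_convex.
  by rewrite !ltW.
- exact: Kle.
have l0 : l 0 = 0 by have := llin 1 0 0; rewrite scaler0 addr0 /= mul1r; lra.
have lD u v : l (u + v) = l u + l v.
  by have := llin 1 u v; rewrite scale1r /= mul1r.
have lZ a u : l (a *: u) = a * l u.
  by have := llin a u 0; rewrite addr0 l0 addr0.
have lbd u : `|l u| <= K * nrm u.
  rewrite ler_norml lK andbT -[l u]opprK lerN2.
  by rewrite -[- l u]mulN1r -lZ scaleN1r (le_trans (lK _)) ?nrmN.
have sdual : is_dual (fun v : E => l (0, v, 0)).
  apply: (@bounded_is_dual R E _ K) => [a v w /=|v].
    by rewrite -lZ -lD /=; congr l; congr (_, _, _); rewrite /= ?scaler0 ?addr0.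
  by apply: le_trans (lbd _) _; rewrite /nrm /= dnorm0 normr0 add0r addr0.
have tdual : is_dual (fun w : E => l (0, 0, w)).
  apply: (@bounded_is_dual R E _ K) => [a v w /=|v].
    by rewrite -lZ -lD /=; congr l; congr (_, _, _); rewrite /= ?scaler0 ?addr0.
  by apply: le_trans (lbd _) _; rewrite /nrm /= dnorm0 normr0 !add0r.
have [a u v w wE||x xP] := reflE (fun u => l (u, 0, 0)).
- have -> : w = a *: u + v by apply: dual_ext => x; rewrite wE !dualE.
  by rewrite -lZ -lD /=; congr l; congr (_, _, _); rewrite /= ?scaler0 ?addr0.
- exists K => u; apply: le_trans (lbd _) _.
  by rewrite /nrm /= normr0 !addr0.
exists x, (exist _ _ sdual), (exist _ _ tdual) => -[[u v] w] r ur /=.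
rewrite -xP /dapp /= -!lD; apply: le_trans (lle _ _ ur).
rewrite le_eqVlt; apply/orP; left; apply/eqP; congr l.
by congr (_, _, _); rewrite /= ?addr0 ?add0r.
Qed.

End duality.

(** * From the dual solution to maximal monotonicity *)

(** The suprema are taken one at a time: a fixed [z] with [f z] finite shows that [g p'] is finite,
    and only then is the supremum over [z] taken. *)
Lemma fconj_sum_le (R : realType) (E : normedModType R)
    (f g : E * dual E -> \bar R) (p p' : E * dual E) (A : R) :
  proper_fun f -> proper_fun g ->
  (f p <= fconj f p)%E -> (g p' <= fconj g p')%E ->
  (forall z w (r1 r2 : R), (f z <= r1%:E)%E -> (g w <= r2%:E)%E ->
     bil z p - r1 + (bil w p' - r2) <= A) ->
  exists a b : R, [/\ f p = a%:E, g p' = b%:E & a + b <= A].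
Proof.
move=> [fNoo [z0 fz0]] [gNoo [w0 gw0]] ff gg le.
have bound (k : E * dual E -> \bar R) (q : E * dual E) (B : R) :
    (forall z, k z != -oo%E) -> (k q <= fconj k q)%E ->
    (forall z r, (k z <= r%:E)%E -> bil z q - r <= B) ->
    exists2 a : R, k q = a%:E & a <= B.
  move=> kNoo kq kB.
  have kqB : (k q <= B%:E)%E.
    apply: le_trans kq _; apply: ub_ereal_sup => _ [z _ <-].
    have := kNoo z; have := kB z; case: (k z) => [r|_ _|//].
      by move=> /(_ r (lexx _)) h _; rewrite -EFinB lee_fin.
    by rewrite addeNy leNye.
  move: kqB (kNoo q); case: (k q) => [a|//|//]; rewrite lee_fin => aB _.
  by exists a.
have gB z r1 : (f z <= r1%:E)%E -> exists2 b : R, g p' = b%:E & bil z p - r1 + b <= A.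
  move=> fz; have [|b gb bA] := bound g p' (A - (bil z p - r1)) gNoo gg.
    by move=> w r2 gw; have := le _ _ _ _ fz gw; lra.
  by exists b => //; lra.
have [|b gb _] := gB z0 (fine (f z0)); first by rewrite fineK.
have [|a fa aA] := bound f p (A - b) fNoo ff.
  by move=> z r1 /gB [b']; rewrite gb => -[<-]; lra.
by exists a, b; split=> //; lra.
Qed.

(** Replacing [c] by [t c] and dividing by [t] sends the bound to 0 with [t]; hence [u <= 0], and
    [u] is odd. *)
Lemma dual_eq0_of_quadratic (R : realType) (E : normedModType R) (u : dual E) :
  (forall c, dapp u c <= `|c| ^+ 2 / 2) -> u = 0.
Proof.
move=> uc; apply: dual_ext => v; rewrite dualE.
have le0 w : dapp u w <= 0.
  apply/ler_addgt0Pr => e e0; rewrite add0r.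
  pose k := `|w| ^+ 2 + 1.
  have k0 : 0 < k by rewrite /k ltr_wpDl // sqr_ge0.
  have t0 : 0 < e / k by rewrite divr_gt0.
  have := uc ((e / k) *: w); rewrite dappZ normrZ gtr0_norm //.
  have -> : (e / k * `|w|) ^+ 2 / 2 = e / k * (e * (`|w| ^+ 2 / k) / 2) by ring.
  rewrite ler_pM2l // => /le_trans; apply.
  have h : `|w| ^+ 2 / k <= 1 by rewrite ler_pdivrMr // mul1r /k lerDl.
  by nra.
by apply/le_anti; rewrite le0 -oppr_le0 -dappN le0.
Qed.

Section maximality.
Variables (R : realType) (E : completeNormedModType R).
Variables f g : E * dual E -> \bar R.
Hypothesis reflE : reflexive_space E.
Hypotheses (BCf : BC_fun f) (lscf : lsc_fun f).
Hypotheses (BCg : BC_fun g) (lscg : lsc_fun g).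
Hypothesis subF : closed_subspace [set y : E | exists (l : R) (a b : E),
  0 < l /\ pi1_dom f a /\ pi1_dom g b /\ y = l *: (a - b)].

(* The analogue of the surjectivity of [A + J] for a maximally monotone [A]:
   a point [(y, ys)] that is monotonically related to the single point
   [(x, s + t)] already coincides with it. *)
Lemma Pq_sum_near (y : E) (ys : dual E) : exists (x : E) (s t : dual E),
  [/\ Pq f (x, s), Pq g (x, t) &
    0 <= dapp (s + t - ys) (x - y) -> x = y /\ ys = s + t].
Proof.
have [propf [convf [ff qf_le]]] := BCf; have [propg [convg [gg qg_le]]] := BCg.
have [x [s [t sub]]] := perturbation_subgradient propf convf lscf propg convg
  lscg qf_le qg_le subF y ys reflE.
pose xi := x - y; pose sg := s + t - ys.
(* [A ga c] is what the subgradient inequality leaves on the right once [bil z (x, s) - r1] and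
   [bil w (x, t) - r2] are isolated; it is independent of [z] and [w]. *)
pose A ga c := (dnorm ga ^+ 2 + `|c| ^+ 2) / 2 - dapp ga xi - dapp sg c +
  dapp ys x - dapp ys y + dapp s y + dapp t y.
have sumA ga c : exists a b : R,
    [/\ f (x, s) = a%:E, g (x, t) = b%:E & a + b <= A ga c].
  apply: fconj_sum_le => // z w r1 r2 fz gw.
  have /= := sub (z.2 + w.2 + ga - ys, z.1 + c - y, w.1 + c - y) _ _.
  move=> /(_ _ (ex_intro _ z (ex_intro _ w (ex_intro _ ga (ex_intro _ c
    (ex_intro _ r1 (ex_intro _ r2 (And4 fz gw erefl (lexx _))))))))).
  by rewrite /A /xi /sg /bil !dualE !dappB !dappD /=; lra.
have [a [b [fa gb _]]] := sumA 0 0.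
have {}sumA ga c : a + b <= A ga c.
  by have [a' [b' []]] := sumA ga c; rewrite fa gb => -[<-] [<-].
have sa : dapp s x <= a by have := qf_le (x, s); rewrite fa lee_fin.
have tb : dapp t x <= b by have := qg_le (x, t); rewrite gb lee_fin.
(* This [ga] brings [|ga|^2 / 2 - <xi, ga>] down to at most [- |xi|^2 / 2]. *)
have [ga ga1 gaxi] := norming_dual xi.
have ga2 : dnorm ga ^+ 2 <= `|xi| ^+ 2.
  by rewrite ler_sqr ?nnegrE ?dnorm_ge0.
have Ale c : a + b + `|xi| ^+ 2 / 2 + dapp sg c + dapp sg xi <=
    `|c| ^+ 2 / 2 + dapp s x + dapp t x.
  have sgxi : dapp sg xi = dapp s x + dapp t x - dapp ys x -
      (dapp s y + dapp t y - dapp ys y) by rewrite /sg /xi !dualE !dappB; ring.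
  by have := sumA ga c; rewrite /A gaxi sgxi; lra.
(* At [c = - xi] everything cancels but [a + b <= <x, s> + <x, t>], so [sa] and [tb] are
   equalities. *)
have := Ale (- xi); rewrite normrN dappN => Axi.
have sE : a = dapp s x by lra.
have tE : b = dapp t x by lra.
exists x, s, t; split; [by rewrite /Pq /= fa sE|by rewrite /Pq /= gb tE|].
rewrite -/xi -/sg => mon.
(* [Ale] now reads [|xi|^2 / 2 + <c, sg> + <xi, sg> <= |c|^2 / 2]: [c = 0] with [mon] kills [xi],
   and then varying [c] kills [sg]. *)
have xi0 : xi = 0.
  apply/eqP; rewrite -normr_eq0 -sqrf_eq0; apply/eqP/le_anti.
  rewrite sqr_ge0 andbT.
  by have := Ale 0; rewrite dapp0 normr0; lra.
have sg0 : sg = 0.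
  apply: dual_eq0_of_quadratic => c.
  by have := Ale c; rewrite xi0 normr0 dapp0; lra.
by split; [exact: subr0_eq xi0|apply/esym/subr0_eq].
Qed.

End maximality.

(* Compare [k] with [q] at the midpoint of the two points. *)
Lemma Pq_monotone (R : realType) (E : normedModType R)
    (k : E * dual E -> \bar R) (x y : E) (s t : dual E) : convex_fun k ->
  (forall z, ((qf z)%:E <= k z)%E) -> Pq k (x, s) -> Pq k (y, t) ->
  0 <= dapp (s - t) (x - y).
Proof.
move=> convk qk; rewrite /Pq /qf /= => kx ky.
have := convk 2^-1 (x, s) (y, t) (2^-1 *: s + (1 - 2^-1) *: t).
have h01 : 0 < (2^-1 : R) < 1 by rewrite invr_gt0 ltr0n /= invf_lt1 // ltr1n.
move=> /(_ h01 (fun y => erefl)); rewrite kx ky -!EFinM -EFinD.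
move=> /(le_trans (qk _)); rewrite lee_fin.
rewrite -[qf _]/(dapp (2^-1 *: s + (1 - 2^-1) *: t) (2^-1 *: x + (1 - 2^-1) *: y)).
rewrite !dualE !dappB !dappD !dappZ.
have -> : 1 - 2^-1 = 2^-1 :> R by field.
lra.
Qed.

Unset Implicit Arguments.

Theorem theorem5p4 (R : realType) (E : completeNormedModType R)
  (f g : E * dual E -> \bar R) :
  (exists x : E, x != 0) ->
  reflexive_space E ->
  BC_fun f -> lsc_fun f ->
  BC_fun g -> lsc_fun g ->
  closed_subspace
    [set y : E | exists (l : R) (a b : E),
        0 < l /\ pi1_dom f a /\ pi1_dom g b /\ y = l *: (a - b)] ->
  max_monotone
    [set z : E * dual E | exists s t : dual E,
        Pq f (z.1, s) /\ Pq g (z.1, t) /\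
        forall y, dapp z.2 y = dapp s y + dapp t y].
Proof.
move=> _ reflE BCf lscf BCg lscg subF.
have near := Pq_sum_near reflE BCf lscf BCg lscg subF.
have [_ [convf [_ qf_le]]] := BCf; have [_ [convg [_ qg_le]]] := BCg.
split.
  split.
    (* Any base point would do: solvability alone gives nonemptiness. *)
    have [x [s [t [fs gt _]]]] := near 0 0.
    by exists (x, s + t), s, t.
  move=> z w [s [t [fs [gt zE]]]] [s' [t' [fs' [gt' wE]]]].
  rewrite zE wE.
  have := Pq_monotone convf qf_le fs fs'; have := Pq_monotone convg qg_le gt gt'.
  by rewrite !dualE; lra.
move=> B [_ monB] AB; apply/seteqP; split=> // -[y ys] By.
(* The point found for [(y, ys)] belongs to the set, hence to [B]; monotonicity of [B] identifies
   the two. *)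
have [x [s [t [fs gt eqxy]]]] := near y ys.
have := monB _ _ (AB (x, s + t) _) By => /(_ _) /=.
rewrite -[X in 0 <= X]/(dapp (s + t) (x - y) - dapp ys (x - y)) => h.
have [|xy ysE] := eqxy; last by exists s, t; rewrite -xy ysE.
by rewrite dual_addE dual_oppE; apply: h; exists s, t.
Qed.
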